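(* Every combinatorial sphere is orientable.
   Context: A simplicial complex is a finite nonempty collection of finite sets closed under subsets (so it contains $\emptyset$); $\dim\sigma=|\sigma|-1$; $\alpha$ is a facet of $\beta$ if $\alpha\subseteq\beta$ and $\dim\alpha=\dim\beta-1$. A total order on the vertices is fixed; a $q$-simplex with vertices $x_0<\dots<x_q$ is the oriented simplex $[x_0,\dots,x_q]$; $C_q$ is the free $\mathbb Z$-module on the $q$-simplices ($q\ge0$). For a $q$-simplex $\sigma=[x_0,\dots,x_q]$ and a $(q-1)$-simplex $\tau$, $[\sigma,\tau]=(-1)^i$ if $\tau=\sigma\setminus\{x_i\}$, $0$ if $\tau\not\subseteq\sigma$; $\partial_q\sigma=\sum_\tau[\sigma,\tau]\tau$ for $q\ge1$, $\partial_0=0$. A discrete vector field $\mathcal V$ is a set of pairs $(\alpha,\beta)$ of simplices ($\alpha=\emptyset$ allowed) with $\alpha$ a facet of $\beta$, each simplex in at most one pair. A $\mathcal V$-trajectory is a sequence $\beta_0,\alpha_1,\beta_1,\dots,\alpha_r,\beta_r$ of alternately $q$- and $(q-1)$-simplices with $(\alpha_i,\beta_i)\in\mathcal V$, $\alpha_i\subsetneq\beta_{i-1}$, $\beta_{i-1}\ne\beta_i$; nontrivial closed if $r>0$ and $\beta_r=\beta_0$. A gradient vector field has no nontrivial closed trajectory. A nonempty simplex is critical if it lies in no pair, or is a $0$-simplex $\sigma$ with $(\emptyset,\sigma)\in\mathcal V$. A $d$-dimensional pseudomanifold: all maximal simplices have dimension $d$, every $(d-1)$-simplex lies in exactly two $d$-simplices,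 and any two $d$-simplices are joined by a sequence of $d$-simplices with consecutive ones meeting in a $(d-1)$-simplex. A combinatorial $d$-sphere is a $d$-dimensional pseudomanifold admitting a gradient vector field with exactly two critical simplices, one $d$-dimensional and one $0$-dimensional. If $\sigma_1,\dots,\sigma_n$ are the $d$-simplices of a combinatorial $d$-sphere $\mathcal S$, an orientation of $\mathcal S$ is a tuple $(\xi_1,\dots,\xi_n)\in\{\pm1\}^n$ with $\partial_d(\sum_i\xi_i\sigma_i)=0$; $\mathcal S$ is orientable if it has an orientation. *)

(* Defs.v *)
From HB Require Import structures.
From mathcomp Require Import all_boot all_order all_algebra.

Set Implicit Arguments.
Unset Strict Implicit.
Unset Printing Implicit Defensive.

Import Order.TTheory GRing.Theory Num.Theory.
Local Open Scope ring_scope.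

Section Complexes.
Variables (disp : Order.disp_t) (T : finOrderType disp).
Implicit Types (K : {set {set T}}) (V : {set {set T} * {set T}}).
Implicit Types (s t a b : {set T}).

(* T may contain elements that are not vertices of K. *)
Definition simplicial_complex K : Prop :=
  K != set0 /\ forall s t, s \in K -> t \subset s -> t \in K.

Definition dim s : int := #|s|%:Z - 1.

Definition facet a b : bool := (a \subset b) && (dim a == dim b - 1).

Definition simplices K (q : int) : {set {set T}} := [set s in K | dim s == q].

Definition simplex_of K (q : int) : finType := {s : {set T} | s \in simplices K q}.

Definition vertices s : seq T := sort <=%O (enum s).

(* For t of dimension dim s - 1, there is at most one x in s with t = s :\ x,
   and there is none exactly when t is not contained in s. *)
Definition incidence s t : int :=
  if [pick x in s | t == s :\ x] is Some x then (-1) ^+ index x (vertices s)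
  else 0.

Definition chain K (q : int) : zmodType := {ffun simplex_of K q -> int}.

Definition basis_chain K q (s : simplex_of K q) : chain K q :=
  [ffun t => (t == s)%:R].

(* For q = 0 the target chain K (-1) is spanned by the empty simplex: the
   boundary is nevertheless 0, i.e. the complex is not augmented. *)
Definition boundary K (q : nat) (c : chain K q) : chain K (q%:Z - 1) :=
  if q == 0%N then 0
  else \sum_(s : simplex_of K q)
         (\sum_(t : simplex_of K (q%:Z - 1))
            basis_chain t *~ incidence (val s) (val t)) *~ c s.

Definition discrete_vector_field K V : Prop :=
  (forall a b, (a, b) \in V -> [/\ a \in K, b \in K & facet a b]) /\
  (forall s p p', p \in V -> p' \in V ->
     s \in [:: p.1; p.2] -> s \in [:: p'.1; p'.2] -> p = p').

(* beta 0, alpha 1, beta 1, ..., alpha r, beta r; the other values of alpha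
   and beta are irrelevant. *)
Definition trajectory K V (q : int) (r : nat) (alpha beta : nat -> {set T}) :
    Prop :=
  (forall i, (i <= r)%N -> beta i \in simplices K q) /\
  (forall i, (i < r)%N ->
     [/\ alpha i.+1 \in simplices K (q - 1), (alpha i.+1, beta i.+1) \in V,
         alpha i.+1 \proper beta i & beta i != beta i.+1]).

Definition gradient_vector_field K V : Prop :=
  discrete_vector_field K V /\
  forall q r alpha beta, trajectory K V q r alpha beta -> (0 < r)%N ->
    beta r <> beta 0%N.

Definition paired V s : bool :=
  [exists p in V, (s == p.1) || (s == p.2)].

Definition critical K V : {set {set T}} :=
  [set s in K | (s != set0) &&
     (~~ paired V s || ((dim s == 0) && ((set0, s) \in V)))].

Definition adjacent K (d : nat) : rel {set T} :=
  fun s t => [&& s \in simplices K d, t \in simplices K d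
               & s :&: t \in simplices K (d%:Z - 1)].

Definition pseudomanifold (d : nat) K : Prop :=
  [/\ simplicial_complex K,
      forall s, maxset [in K] s -> dim s = d,
      forall t, t \in simplices K (d%:Z - 1) ->
        #|[set s in simplices K d | t \subset s]| = 2
    & forall s t, s \in simplices K d -> t \in simplices K d ->
        connect (adjacent K d) s t].

Definition combinatorial_sphere (d : nat) K : Prop :=
  pseudomanifold d K /\
  exists V, gradient_vector_field K V /\
    exists s t, [/\ s != t, critical K V = [set s; t], dim s = d & dim t = 0].

Definition orientation (d : nat) K (xi : {ffun simplex_of K d -> int}) : Prop :=
  (forall u, xi u = 1 \/ xi u = -1) /\
  boundary (\sum_(s : simplex_of K d) basis_chain s *~ xi s) = 0.

Definition orientable (d : nat) K : Prop := exists xi, @orientation d K xi.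

End Complexes.

(* Main.v *)
Require Import Defs.
From mathcomp Require Import all_boot all_order all_algebra.
From mathcomp Require Import zify ring.
Set Implicit Arguments.
Unset Strict Implicit.
Unset Printing Implicit Defensive.
Import Order.TTheory GRing.Theory Num.Theory.
Local Open Scope ring_scope.

(** Let s0 be the critical top simplex. Every other top simplex is paired with
    one of its facets, across which lies exactly one further top simplex; by
    acyclicity these facets form a spanning tree of the dual graph, rooted at s0.
    Choosing signs along the tree makes the boundary z of the signed sum of top
    simplices vanish on all facets paired with a top simplex. The simplices left
    in the support of z are paired with one of their own facets r, and since z is
    a cycle each of them meets another one in r: following r backwards yields a
    closed trajectory, so z = 0. In dimension 1 the critical vertex could also
    lie in the support, but then it would be alone there, which the augmentation
    (the empty simplex as r) forbids. *)

Section Orientation.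
Variables (disp : Order.disp_t) (T : finOrderType disp).
Implicit Types (K : {set {set T}}) (V : {set {set T} * {set T}}).
Implicit Types (s t a b : {set T}).

(** * Simplices, facets and incidence numbers *)

Lemma in_simplices K (q : nat) s :
  (s \in simplices K q) = (s \in K) && (#|s| == q.+1).
Proof. rewrite inE /Defs.dim; congr (_ && _); apply/eqP/eqP; lia. Qed.

Lemma simplices_pred K (q : nat) : simplices K (q.+1%:Z - 1) = simplices K q.
Proof. by rewrite (_ : q.+1%:Z - 1 = q%:Z) //; lia. Qed.

Lemma facet_card a b : facet a b -> #|b| = #|a|.+1.
Proof. by case/andP=> sub; rewrite /Defs.dim => /eqP h; lia. Qed.

Lemma index_vertices s x :
  x \in s -> index x (vertices s) = #|[set y in s | (y < x)%O]|.
Proof.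
move=> xs; have xv : x \in vertices s by rewrite mem_sort mem_enum.
have srt : sorted <%O (vertices s) by rewrite sort_lt_sorted enum_uniq.
rewrite -[LHS](count_lt_nth x srt) ?index_mem // nth_index //.
by rewrite count_sort -sum1_count big_enum_cond sum1_card cardsE.
Qed.

(** At most one [x] contributes, and its position in the sorted vertex list is the number of smaller
    vertices. As a sum, the incidence number can take part in exchanges of summation. *)
Lemma incidence_sum s t :
  incidence s t =
  \sum_(x in s) (t == s :\ x)%:R * (-1) ^+ #|[set y in s | (y < x)%O]|.
Proof.
rewrite /incidence; case: pickP => [x /andP[xs /eqP tE]|none].
  rewrite index_vertices // (bigD1 x) //= tE eqxx mul1r big1 ?addr0 //.
  move=> y /andP[ys nyx]; rewrite [_ == _](negbTE _) ?mul0r //.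
  by apply/eqP => /setP/(_ x); rewrite !inE eqxx xs eq_sym nyx.
by rewrite big1 // => x xs; move: (none x); rewrite xs /= => ->; rewrite mul0r.
Qed.

Lemma incidence_neq0 s t :
  (incidence s t != 0) = [exists x in s, t == s :\ x].
Proof.
rewrite /incidence; case: pickP => [x sx|none].
  by rewrite signr_eq0; symmetry; apply/exists_inP; exists x; case/andP: sx.
rewrite eqxx; symmetry; apply/exists_inP => -[x xs tx].
by move: (none x); rewrite xs tx.
Qed.

Lemma facet_incidence a b : facet a b -> incidence b a != 0.
Proof.
move=> /[dup]/facet_card cab /andP[sab _]; rewrite incidence_neq0.
have : #|b :\: a| == 1%N by rewrite cardsD (setIidPr sab) cab subSnn.
case/cards1P => x xE; apply/exists_inP; exists x.
  by have := set11 x; rewrite -xE => /setDP[].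
apply/eqP; rewrite -xE setDDr setDv set0U; exact/esym/setIidPr.
Qed.

Lemma incidence_facet s t :
  incidence s t != 0 -> t \subset s /\ #|s| = #|t|.+1.
Proof.
rewrite incidence_neq0 => /exists_inP[x xs /eqP->].
by rewrite subD1set (cardsD1 x s) xs.
Qed.

Lemma incidence_sqr s t :
  incidence s t != 0 -> incidence s t * incidence s t = 1.
Proof.
by rewrite /incidence; case: pickP => // x _ _; rewrite -expr2 sqrr_sign.
Qed.

(* Deleting x and then y, or y and then x, contributes opposite signs. *)
Lemma incidence_comp s r :
  \sum_(t : {set T}) incidence s t * incidence t r = 0.
Proof.
pose p x s := #|[set y in s | (y < x)%O]|.
pose G x y : int := if [&& x \in s, y \in s & x != y] then
  (r == s :\: [set x; y])%:R * ((-1) ^+ p x s * (-1) ^+ p y (s :\ x)) else 0.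
(* For [x != y] exactly one of [x < y] and [y < x] holds, so the exponents in [G x y] and [G y x]
   differ by one. *)
have pD x y : x \in s -> p y s = ((x < y)%O + p y (s :\ x))%N.
  move=> xs; rewrite /p (cardsD1 x) !inE xs; congr (_ + #|pred_of_set _|)%N.
  by apply/setP => z; rewrite !inE andbA.
have GN x y : G x y = - G y x.
  rewrite /G eq_sym andbCA; case: and3P => [[ys xs nyx]|_]; last by rewrite oppr0.
  rewrite setUC -mulrN; congr (_ * _).
  rewrite (pD _ _ ys) (pD _ _ xs) !exprD.
  by case: ltgtP nyx => // _ _; rewrite ?expr1 ?expr0; ring.
have -> : \sum_t incidence s t * incidence t r = \sum_x \sum_y G x y.
  under eq_bigr => t _ do rewrite (incidence_sum s) mulr_suml.
  rewrite exchange_big /= [LHS]big_mkcond; apply: eq_bigr => x _.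
  case: ifP => xs; last by rewrite big1 // => y _; rewrite /G xs.
  rewrite (bigD1 (s :\ x)) //= eqxx mul1r [X in _ + X]big1 ?addr0; last first.
    by move=> t /negbTE->; rewrite !mul0r.
  rewrite incidence_sum mulr_sumr big_mkcond; apply: eq_bigr => y _.
  rewrite /G xs !inE eq_sym andbC; case: ifP => // _.
  by rewrite setDDl mulrCA.
(* An integer equal to its own negative is 0. *)
have: \sum_x \sum_y G x y = - \sum_x \sum_y G x y.
  rewrite {1}exchange_big /= -sumrN; apply: eq_bigr => x _.
  by rewrite -sumrN; apply: eq_bigr => y _; rewrite GN.
lia.
Qed.

(** * Acyclicity of the gradient field *)

(** Each [b] in [A] has a possible predecessor [p.2] in a trajectory, again in [A]. Since [A] is
    finite, stepping backwards repeats a simplex and so closes a trajectory. *)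
Lemma backward_closed_eq0 K V (q : int) (A : {set {set T}}) :
  gradient_vector_field K V -> A \subset simplices K q ->
  (forall b, b \in A ->
     exists p, [/\ (p.1, b) \in V, p.2 \in A, p.2 != b & p.1 \subset p.2]) ->
  A = set0.
Proof.
move=> [[Vf _] acyc] AK back; apply/eqP/set0Pn => -[b0 b0A].
have /fin_all_exists[p pP] : forall b, exists p, b \in A ->
    [/\ (p.1, b) \in V, p.2 \in A, p.2 != b & p.1 \subset p.2].
  move=> b; case: (boolP (b \in A)) => [/back[p]|_]; first by exists p.
  by exists (set0, set0).
pose f b := (p b).2; pose n := fingraph.order f b0.
have fA i : iter i f b0 \in A by elim: i => //= i /pP[].
have /trajectP[i ltin iE] : iter n f b0 \in traject f b0 n by exact: looping_order.
(* The orbit is read in reverse: it starts at iterate [n], which equals iterate [i], and reaches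
   iterate [i] after [n - i] steps. *)
apply: (acyc q (n - i)%N (fun k => (p (iter (n - k) f b0)).1)
   (fun k => iter (n - k) f b0)); last 2 first.
- by rewrite subn_gt0.
- by rewrite subKn ?subn0 // ltnW.
split=> [k _|k lk]; first exact: (subsetP AK).
set x := iter (n - k.+1) f b0.
have -> : iter (n - k) f b0 = f x by rewrite -iterS; congr iter; lia.
have [pV pA px ps] := pP x (fA _); have [aK xK fax] := Vf _ _ pV.
have dq b : b \in A -> Defs.dim b = q.
  by move/(subsetP AK); rewrite inE => /andP[_ /eqP].
split=> //.
  by rewrite inE aK -(dq x (fA _)); case/andP: fax.
rewrite properEneq ps andbT; apply/eqP => pE.
have := dq (f x) pA; rewrite -pE -(dq x (fA _)); case/andP: fax => _ /eqP ->; lia.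
Qed.

(** * Coefficients of chains and boundaries *)

Lemma chain_mulrzE K (q : int) (c : chain K q) (m : int) u :
  (c *~ m) u = c u *~ m.
Proof. by case: m => m; rewrite ?NegzE ?mulrNz -!pmulrn ?ffunE ffunMnE. Qed.

Lemma chain_expand K (q : int) (c : simplex_of K q -> int) :
  \sum_(s : simplex_of K q) basis_chain s *~ c s = [ffun s => c s].
Proof.
have termE (s u : simplex_of K q) : (basis_chain s *~ c s) u = (u == s)%:R *~ c s.
  by rewrite chain_mulrzE ffunE.
apply/ffunP => u; rewrite sum_ffunE ffunE (eq_bigr _ (fun i _ => termE i u)).
rewrite (bigD1 u) //= eqxx intz big1 ?addr0 // => s nsu.
by rewrite eq_sym (negbTE nsu) mul0rz.
Qed.

Lemma boundary_eq0 K (n : nat) (xi : {ffun simplex_of K n.+1 -> int}) :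
  (forall t, t \in simplices K n ->
     \sum_(s : simplex_of K n.+1) incidence (val s) t * xi s = 0) ->
  boundary (\sum_(s : simplex_of K n.+1) basis_chain s *~ xi s) = 0.
Proof.
move=> h; rewrite chain_expand /boundary /=; apply/ffunP => t.
have tK : val t \in simplices K n by rewrite -simplices_pred; exact: valP.
have termE (s : simplex_of K n.+1) : ((\sum_(t' : simplex_of K (n.+1%:Z - 1))
    basis_chain t' *~ incidence (val s) (val t')) *~ [ffun s => xi s] s) t =
    incidence (val s) (val t) * xi s.
  by rewrite chain_expand chain_mulrzE !ffunE -mulrzr intz.
rewrite sum_ffunE (eq_bigr _ (fun i _ => termE i)) h //.
by rewrite ffunE.
Qed.

(** * Signs along the tree of top simplices *)

(** The sign of [x] is the product of [e] along the path from [x] to the root [x0]. *)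
Lemma tree_signs (U : finType) (f : U -> U) (x0 : U) (e : U -> int) :
  f x0 = x0 -> (forall x, fconnect f x x0) ->
  (forall x, e x = 1 \/ e x = -1) ->
  exists xi : U -> int, (forall x, xi x = 1 \/ xi x = -1) /\
    forall x, x != x0 -> xi x = e x * xi (f x).
Proof.
(* Every path reaches the root within [#|U|] steps and stays there. With the value 1 at the root,
   all products can have the same length. *)
move=> fx0 cx0 e1; pose e' x := if x == x0 then 1 else e x.
pose xi x := \prod_(i < #|U|) e' (iter i f x).
exists xi; split=> [x|x nx].
  apply: (big_ind (fun z : int => z = 1 \/ z = -1)); first by left.
    by move=> y z [] -> [] ->; [left|right|right|left].
  by move=> i _; rewrite /e'; case: ifP => _; [left|apply: e1].
have itx0 k : iter k f x0 = x0 by elim: k => //= k ->.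
have itN : iter #|U| f x = x0.
  rewrite -(subnK (_ : findex f x x0 <= #|U|)%N); last first.
    apply: leq_trans (max_card (fconnect f x)).
    by rewrite ltnW // findex_max.
  by rewrite iterD iter_findex.
have -> : e x = e' x by rewrite /e' (negbTE nx).
have -> : xi x = \prod_(i < #|U|.+1) e' (iter i f x).
  by rewrite big_ord_recr /= itN /e' eqxx mulr1.
rewrite big_ord_recl /=; congr (_ * _); apply: eq_bigr => i _.
by rewrite -iterSr.
Qed.

Lemma pseudomanifold_card d K s :
  pseudomanifold d K -> s \in K -> (#|s| <= d.+1)%N.
Proof.
move=> [_ maxd _ _] sK; have [m mmax sm] := maxset_exists (P := [in K]) sK.
have /(_ m mmax) := maxd; rewrite /Defs.dim => dm.
by apply: leq_trans (subset_leq_card sm) _; lia.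
Qed.

(** The facet [a] paired with [b] lies in [b] and one other top simplex, the parent of [b].
    Vanishing at [a] is thus a single relation between two signs, solvable along the tree. *)
Lemma top_signs n K V s0 :
  pseudomanifold n.+1 K -> gradient_vector_field K V ->
  s0 \in simplices K n.+1 -> ~~ paired V s0 ->
  (forall s, s \in simplices K n.+1 -> s != s0 -> paired V s) ->
  exists xi : {set T} -> int, (forall s, xi s = 1 \/ xi s = -1) /\
    forall a b, (a, b) \in V -> b \in simplices K n.+1 ->
      \sum_(s in simplices K n.+1) incidence s a * xi s = 0.
Proof.
move=> pmK grV s0K s0free pairedK.
have [[Vf Vuniq] _] := grV; have [_ _ two _] := pmK.
pose D := simplices K n.+1.
have parentP b : exists p : {set T} * {set T}, b \in D -> b != s0 ->
    [/\ (p.1, b) \in V, p.2 != b & [set s in D | p.1 \subset s] = [set b; p.2]].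
  have [bD|_] := boolP (b \in D); last by exists (set0, set0).
  have [_|nb] := eqVneq b s0; first by exists (set0, set0).
  have /exists_inP[[a b'] pV] := pairedK b bD nb.
  have [aK bK fab] := Vf _ _ pV.
  have bc : #|b| = n.+2 by move: bD; rewrite in_simplices => /andP[_ /eqP].
  case/orP => /= /eqP bE; first last.
    subst b'; have aD : a \in simplices K (n.+1%:Z - 1).
      by rewrite simplices_pred in_simplices aK; have := facet_card fab; lia.
    have /eqP/cards2P[x [y [nxy xyE]]] := two a aD.
    have : b \in [set x; y].
      by rewrite -xyE inE -/D bD; case/andP: fab.
    case/set2P => bE; subst b.
      by exists (a, y) => _ _; rewrite pV eq_sym nxy -xyE.
    by exists (a, x) => _ _; rewrite pV nxy setUC -xyE.
  (* If [b] were the smaller member of its pair, its partner would exceed the top dimension. *)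
  subst a; have := pseudomanifold_card pmK bK.
  by rewrite (facet_card fab) bc ltnn.
have /fin_all_exists[p pP] := parentP.
(* Sets that are not top simplices are sent to the root, so that [tree_signs] applies to all of
   [{set T}]. *)
pose f b := if (b \in D) && (b != s0) then (p b).2 else s0.
pose e b : int := - (incidence b (p b).1 * incidence (f b) (p b).1).
pose e' b : int := if (b \in D) && (b != s0) then e b else 1.
have fE b : b \in D -> b != s0 -> f b = (p b).2 by rewrite /f => -> ->.
have parent_in b : b \in D -> b != s0 -> (f b \in D) && ((p b).1 \subset f b).
  move=> bD nb; have [_ _ /setP/(_ (f b))] := pP b bD nb.
  by rewrite !inE -fE // eqxx orbT -/D => ->.
have incb b : b \in D -> b != s0 -> incidence b (p b).1 != 0.
  move=> bD nb; have [pV _ _] := pP b bD nb.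
  by apply: facet_incidence; case: (Vf _ _ pV).
have incf b : b \in D -> b != s0 -> incidence (f b) (p b).1 != 0.
  move=> bD nb; have [pV _ _] := pP b bD nb.
  apply: facet_incidence; have /andP[fD sub] := parent_in b bD nb.
  rewrite /facet sub /=; have [_ _ /andP[_ /eqP->]] := Vf _ _ pV.
  by move: fD bD; rewrite !inE => /andP[_ /eqP->] /andP[_ /eqP->].
have e'1 b : e' b = 1 \/ e' b = -1.
  rewrite /e'; case: ifP => [/andP[bD nb]|_]; last by left.
  apply/pred2P; rewrite -eqf_sqr expr1n /e sqrrN exprMn !expr2.
  by rewrite !incidence_sqr ?incf ?incb.
have fs0 : f s0 = s0 by rewrite /f eqxx andbF.
have root b : fconnect f b s0.
  (* The simplices that never reach the root are closed under taking parents. *)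
  suff A0 : [set b | ~~ fconnect f b s0] = set0.
    by move/setP/(_ b): A0; rewrite !inE => /negbFE.
  have AP x : ~~ fconnect f x s0 -> x \in D /\ x != s0.
    move=> nx; apply/andP; apply: contraNT nx => nx.
    by have := fconnect1 f x; rewrite {2}/f (negbTE nx).
  apply: (backward_closed_eq0 (q := n.+1) grV).
    by apply/subsetP => x; rewrite inE => /AP[].
  move=> x; rewrite inE => nx; have [xD nx0] := AP x nx.
  have [pV pb _] := pP x xD nx0; exists (p x); split=> //.
    rewrite inE -fE //; apply: contraNN nx => h.
    exact: connect_trans (fconnect1 f x) h.
  by rewrite -fE //; have /andP[] := parent_in x xD nx0.
have [xi [xi1 xiE]] := tree_signs fs0 root e'1.
exists xi; split=> // a b abV bD.
have nb : b != s0.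
  apply: contraNneq s0free => <-; apply/exists_inP; exists (a, b) => //=.
  by rewrite eqxx orbT.
have [pV pb pE] := pP b bD nb.
have [aE] : (a, b) = ((p b).1, b).
  by apply: (Vuniq b) => //; rewrite !inE eqxx orbT.
have sumE s : incidence s a * xi s != 0 -> s \in D -> s \in [set b; f b].
  move=> nz sD; rewrite fE // -pE inE sD -aE.
  have : incidence s a != 0 by apply: contraNneq nz => ->; rewrite mul0r.
  by case/incidence_facet.
have /andP[fD _] := parent_in b bD nb.
rewrite (bigD1 b) //= (bigD1 (f b)) /=; last by rewrite fD fE.
rewrite big1 ?addr0; last first.
  move=> s /andP[/andP[sD nsb] nsf]; apply/eqP/negPn/negP => /sumE/(_ sD).
  by rewrite !inE (negbTE nsb) (negbTE nsf).
rewrite (xiE b nb) /e' -/D bD nb /= /e aE.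
have := incidence_sqr (incb b bD nb).
set u := incidence b _; set v := incidence (f b) _ => uu.
have -> : u * (- (u * v) * xi (f b)) + v * xi (f b) =
  (1 - u * u) * (v * xi (f b)) by ring.
by rewrite uu subrr mul0r.
Qed.

(** * Vanishing of the boundary *)

Lemma sphere_orientable n K : combinatorial_sphere n.+1 K -> orientable n.+1 K.
Proof.
move=> [pmK [V [grV [s0 [t0 [ns0 critE ds0 dt0]]]]]].
have [[Vf Vuniq] _] := grV; have [[_ Kclosed] _ _ _] := pmK.
pose D := simplices K n.+1.
have critP s : s \in critical K V -> s = s0 \/ s = t0.
  by rewrite critE => /set2P.
have s0K : s0 \in D.
  have : s0 \in critical K V by rewrite critE set21.
  by rewrite !inE ds0 eqxx andbT => /andP[].
have s0free : ~~ paired V s0.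
  have : s0 \in critical K V by rewrite critE set21.
  by rewrite inE ds0 /= orbF => /and3P[].
have pairedK s : s \in D -> s != s0 -> paired V s.
  rewrite in_simplices => /andP[sK /eqP cs] ns; rewrite -[paired V s]negbK; apply/negP => free.
  have /critP[/eqP|sE] : s \in critical K V by rewrite inE sK -card_gt0 cs free.
    by rewrite (negbTE ns).
  by move: dt0; rewrite -sE /Defs.dim cs.
have [xi [xi1 xiV]] := top_signs pmK grV s0K s0free pairedK.
pose z t := \sum_(s in D) incidence s t * xi s.
suff z0 : [set t | z t != 0] = set0.
  exists [ffun s => xi (val s)]; split=> [u|]; first by rewrite ffunE.
  apply: boundary_eq0 => t _.
  have /setP/(_ t) := z0; rewrite !inE => /negbFE/eqP zt; rewrite -[RHS]zt.
  transitivity (\sum_(s : simplex_of K n.+1) incidence (val s) t * xi (val s)).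
    by apply: eq_bigr => s _; rewrite ffunE.
  exact/esym/(big_sub _ (fun s => incidence s t * xi s)).
have zK t : z t != 0 -> t \in simplices K n.
  move=> nz; have [s sD nzs] : exists2 s, s \in D & incidence s t != 0.
    apply/exists_inP; apply: contraNT nz => /exists_inPn none.
    by apply/eqP/big1 => s /none/negPn/eqP->; rewrite mul0r.
  have [sub cs] := incidence_facet nzs.
  move: sD; rewrite !in_simplices cs eqSS => /andP[sK ->].
  by rewrite (Kclosed s t sK sub).
(* Here [r] may be empty, so [z] is also a cycle for the augmented boundary. *)
have cycle r : \sum_t incidence t r * z t = 0.
  under eq_bigr => t _ do rewrite mulr_sumr.
  rewrite exchange_big big1 // => s _ /=.
  under eq_bigr => t _ do rewrite mulrCA mulrA mulrC.
  by rewrite -mulr_sumr incidence_comp mulr0.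
have other t r : z t != 0 -> facet r t ->
    exists t', [/\ z t' != 0, t' != t & r \subset t'].
  move=> nz frt; have nzr := facet_incidence frt.
  (* A vanishing sum cannot have exactly one nonzero term. *)
  have : [exists t', (t' != t) && (incidence t' r * z t' != 0)].
    apply: contraTT isT => /existsPn none.
    have := cycle r; rewrite (bigD1 t) //= big1 ?addr0.
      by move/eqP; rewrite mulf_eq0 (negbTE nzr) (negbTE nz).
    by move=> t' nt; apply/eqP; have := none t'; rewrite nt negbK.
  case/existsP => t' /andP[nt].
  rewrite mulf_eq0 negb_or => /andP[/incidence_facet[rt _] nzt].
  by exists t'.
have down t : z t != 0 -> t \notin critical K V ->
    exists2 r, (r, t) \in V & facet r t.
  move=> nz; have := zK t nz; rewrite in_simplices => /andP[tK /eqP ct].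
  rewrite inE tK -card_gt0 ct /= negb_or negbK => /andP[/exists_inP[[a b] abV] + _].
  have [aK bK fab] := Vf _ _ abV.
  case/orP => /= /eqP tE; last by exists a; rewrite tE.
  (* If [t] is the smaller member of its pair, its partner is a top simplex, and the choice of signs
     gives [z t = 0]. *)
  subst a; have bD : b \in D by rewrite in_simplices bK (facet_card fab) ct /=.
  by move: nz; rewrite /z (xiV _ _ abV bD) eqxx.
have notcrit t : z t != 0 -> t \notin critical K V.
  move=> nz; have := zK t nz; rewrite in_simplices => /andP[tK /eqP ct].
  apply/negP => /[dup] tcrit /critP[] tE.
    by move: s0K; rewrite -tE in_simplices ct andbC; lia.
  have n0 : n = 0%N by move: dt0; rewrite -tE /Defs.dim ct; lia.
  (* Any other vertex in the support would be noncritical, hence paired with its only facet, the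
     empty simplex; but that makes a vertex critical. *)
  have supp t' : z t' != 0 -> t' = t.
    move=> nz'; suff /critP[t's|->//] : t' \in critical K V.
      have := zK t' nz'; rewrite t's in_simplices => /andP[_].
      by move: s0K; rewrite in_simplices => /andP[_ /eqP->]; lia.
    apply/negPn/negP => /[dup] nc /(down t' nz')[r rV frt].
    have := zK t' nz'; rewrite in_simplices n0 => /andP[tK' /eqP ct'].
    have := facet_card frt; rewrite ct' => -[] /esym/eqP; rewrite cards_eq0.
    move=> /eqP r0; move: nc.
    by rewrite inE tK' -card_gt0 ct' /Defs.dim ct' -r0 rV eqxx orbT.
  have f0t : facet set0 t by rewrite /facet sub0set /Defs.dim ct cards0 n0.
  have [t' [nz' + _]] := other t set0 nz f0t.
  by rewrite (supp t' nz') eqxx.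
apply: (backward_closed_eq0 (q := n) grV).
  by apply/subsetP => t; rewrite inE => /zK.
move=> t; rewrite inE => nz; have [r rV frt] := down t nz (notcrit t nz).
have [t' [nz' nt rt]] := other t r nz frt.
by exists (r, t'); split; rewrite //= inE.
Qed.
End Orientation.

Theorem theoremA2 (disp : Order.disp_t) (T : finOrderType disp)
    (d : nat) (S : {set {set T}}) :
  combinatorial_sphere d S -> orientable d S.
Proof.
case: d => [_|n]; last exact: sphere_orientable.
(* In dimension 0 the boundary is zero by definition, so all signs can be 1. *)
by exists [ffun=> 1]; split=> [u|//]; rewrite ffunE; left.
Qed.
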